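(* There are $\mathfrak{c}$ sequences in $\mathscr{A}$ which generate pairwise nonisomorphic ideals; that is, there exists a subset $\mathscr{B}\subseteq\mathscr{A}$ of cardinality $\mathfrak{c}$ such that for all distinct $x,y\in\mathscr{B}$ the ideals $\mathcal{I}_x$ and $\mathcal{I}_y$ are not isomorphic.
   Context: $\mathbf{N}$ denotes the set of positive integers and $\mathfrak{c}$ the cardinality of the continuum. $\mathscr{X}$ is the set of all sequences $x=(x_n)_{n\in\mathbf{N}}$ of strictly positive real numbers such that $\sum_n x_n=\infty$. For $x\in\mathscr{X}$, the ideal generated by $x$ is $\mathcal{I}_x:=\{A\subseteq\mathbf{N} : \sum_{n\in A}x_n<\infty\}$. For $x,y\in\mathscr{X}$, write $x\sim y$ if $\mathcal{I}_x=\mathcal{I}_y$. Define $\mathscr{Z}:=\{x\in\mathscr{X} : \lim_{n\to\infty}x_n=0\}$, $\mathscr{Y}:=\{y\in\mathscr{X} : \liminf_{n\to\infty} y_{n+1}/y_n>0\}$, and $\mathscr{A}:=\{x\in\mathscr{Z} : \forall y\in\mathscr{Y},\ x\not\sim y\}$. Two ideals $\mathcal{I},\mathcal{J}$ on $\mathbf{N}$ are isomorphic if there exists a bijection $f:\mathbf{N}\to\mathbf{N}$ such that, for all $A\subseteq\mathbf{N}$, $f[A]\in\mathcal{I}$ if and only if $A\in\mathcal{J}$. *)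

(* Defs.v *)
From mathcomp Require Import all_boot all_order all_algebra.
From mathcomp Require Import all_classical all_reals all_analysis.

Set Implicit Arguments.
Unset Strict Implicit.
Unset Printing Implicit Defensive.

Import Order.TTheory GRing.Theory Num.Theory.
Import numFieldNormedType.Exports.

Local Open Scope classical_set_scope.
Local Open Scope ring_scope.

(* Sequences are indexed by [nat] rather than by the positive integers: [x n]
   stands for the term x_(n+1). *)

Definition calX (R : realType) : set (R^nat) :=
  [set x | (forall n, 0 < x n) /\ (\sum_(0 <= n <oo) (x n)%:E = +oo)%E].

Definition ideal_of (R : realType) (x : R^nat) : set (set nat) :=
  [set A | (\esum_(n in A) (x n)%:E < +oo)%E].

Definition ideal_equiv (R : realType) (x y : R^nat) : Prop :=
  ideal_of x = ideal_of y.

Definition calZ (R : realType) : set (R^nat) :=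
  [set x | calX x /\ x n @[n --> \oo] --> 0].

(* The liminf is taken in \bar R, as the ratios may be unbounded. *)
Definition calY (R : realType) : set (R^nat) :=
  [set y | calX y /\ (0 < limn_einf (fun n => (y n.+1 / y n)%:E))%E].

Definition calA (R : realType) : set (R^nat) :=
  [set x | calZ x /\ forall y : R^nat, calY y -> ~ ideal_equiv x y].

Definition isomorphic_ideals (I J : set (set nat)) : Prop :=
  exists f : nat -> nat,
    bijective f /\ forall A : set nat, I (f @` A) <-> J A.

(* Main.v *)
Require Import Defs.
From mathcomp Require Import all_boot all_order all_algebra.
From mathcomp Require Import all_classical all_reals all_analysis.
From mathcomp Require Import ring lra.

(* Two sequences with the same ideal are comparable up to constants off a set of
   the ideal: if v and v / u tend to 0 along a set A, then blocks of A chosen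
   sparsely enough have infinite u-mass but finite v-mass.

   For 1/16 < c < 1/8 let x_n = exp (- c 4^(l n)), where l (2p) tends to infinity
   very slowly and l (2p+1) = l (2p) + 1, so that x_(2p+1) = x_(2p)^4 and the odd
   terms still have infinite sum.
   - If y is in calY then y_(2p+1) >= const y_(2p), so for each p either y_(2p+1)
     is much larger than x_(2p+1) or y_(2p) is much smaller than x_(2p); by the
     comparison principle the odd integers would be in the ideal of x.
   - For c <> d all values c 4^i and d 4^j are far apart, so the terms of the
     sequences of c and d are never comparable, whatever the bijection. *)

Set Implicit Arguments.
Unset Strict Implicit.
Unset Printing Implicit Defensive.
Import Order.TTheory GRing.Theory Num.Theory.
Import numFieldNormedType.Exports.

Local Open Scope classical_set_scope.
Local Open Scope card_scope.
Local Open Scope ring_scope.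

(** * Summable ideals and the comparison principle *)

Section Ideals.
Variable R : realType.
Implicit Types (x y u v : R^nat) (A B C : set nat).

Lemma le_ideal_of u v A : (forall n, A n -> u n <= v n) ->
  ideal_of v A -> ideal_of u A.
Proof.
by move=> uv; apply: le_lt_trans; apply: le_esum => n An; rewrite lee_fin uv.
Qed.

Lemma ideal_of_image u (f : nat -> nat) A : injective f ->
  ideal_of u (f @` A) <-> ideal_of (u \o f) A.
Proof.
by move=> fI; rewrite /ideal_of /= esum_image// => m n _ _; apply: fI.
Qed.

Lemma ideal_of_cover u A B C : (forall n, 0 <= u n) -> C `<=` A `|` B ->
  ideal_of u A -> ideal_of u B -> ideal_of u C.
Proof.
rewrite /ideal_of /= => u0 CAB uA uB.
have := lte_add_pinfty uA uB; apply: le_lt_trans.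
rewrite esum_mkcond [in leRHS]esum_mkcond [X in (_ <= _ + X)%E]esum_mkcond.
have ge0 D n : (0 <= if n \in D then (u n)%:E else 0)%E.
  by case: ifPn; rewrite ?lee_fin.
rewrite -esumD//; apply: le_esum => n _.
case: ifPn => [/set_mem/CAB[]/mem_set->|_]; last by rewrite adde_ge0.
  by rewrite leeDl.
by rewrite leeDr.
Qed.

Lemma esum_seq u (r : seq nat) : (forall n, 0 <= u n) -> uniq r ->
  \esum_(n in [set` r]) (u n)%:E = (\sum_(n <- r) u n)%:E.
Proof.
move=> u0 ur; rewrite esum_fset; last by move=> n _; rewrite lee_fin.
  by rewrite -fsbig_seq// sumEFin.
exact: finite_seq.
Qed.

(** If every block sum starting at [N] stayed below 1, the total mass of [A] would be at most its
    mass below [N] plus 1. *)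
Lemma ge1_block u A (N : nat) : (forall n, 0 <= u n) -> ~ ideal_of u A ->
  exists T : nat, 1 <= \sum_(N <= n < T | n \in A) u n.
Proof.
move=> u0 nuA; apply: contrapT => /forallNP h; apply: nuA; rewrite /ideal_of /=.
have u0' n : (0 <= (u n)%:E)%E by rewrite lee_fin.
rewrite -[A in X in (X < _)%E]set_mem_set -nneseries_esum//.
apply: (@le_lt_trans _ _ (\sum_(0 <= n < N | n \in A) u n + 1)%:E);
  last exact: ltry.
apply: lime_le; first exact: is_cvg_nneseries.
near=> T.
rewrite sumEFin lee_fin (big_cat_nat (n := N))//=; last by near: T; exists N.
rewrite lerD2l; apply/ltW; rewrite ltNge; apply/negP; exact: h.
Unshelve. all: by end_near. Qed.

(** Take [T] least for the first bound. Without its last term the block has [u]-mass below 1, hence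
    [v]-mass at most [e]; the last term adds at most [e] because [v] itself is small there. *)
Lemma light_block u v A (e : R) (M : nat) : 0 < e ->
  (forall n, 0 <= u n) -> (forall n, 0 <= v n) -> ~ ideal_of u A ->
  (\forall n \near \oo, A n -> v n <= e /\ v n <= e * u n) ->
  exists N T, [/\ (M <= N)%N, (N <= T)%N,
    1 <= \sum_(N <= n < T | n \in A) u n &
    \sum_(N <= n < T | n \in A) v n <= e * 2].
Proof.
move=> e0 u0 v0 nuA [N0 _ h].
pose N := maxn M N0.
have ge1 := @ge1_block u A N u0 nuA.
pose T := ex_minn ge1; exists N; exists T; rewrite /T.
case: ex_minnP => {T ge1} -[|T].
  by rewrite big_geq// ler10.
move=> ge1 minT.
have NT : (N <= T)%N.
  rewrite leqNgt; apply/negP => TN.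
  by move: ge1; rewrite big_geq// ler10.
split => //; [exact: leq_maxl|exact: leqW|].
have hN n : (N <= n)%N -> n \in A -> v n <= e /\ v n <= e * u n.
  move=> Nn /set_mem; apply: h => /=; apply: leq_trans Nn; exact: leq_maxr.
have lt1 : \sum_(N <= n < T | n \in A) u n < 1.
  by rewrite ltNge; apply/negP => /minT; rewrite ltnn.
rewrite big_mkcond big_nat_recr//= -big_mkcond/= mulr_natr mulr2n lerD//.
  apply: (@le_trans _ _ (e * \sum_(N <= n < T | n \in A) u n)).
    rewrite mulr_sumr [leLHS]big_nat_cond [leRHS]big_nat_cond.
    by apply: ler_sum => n /andP[/andP[Nn _] nA]; case: (hN n).
  by rewrite -[leRHS]mulr1 ler_pM2l// ltW.
by case: ifPn => [TA|_]; [case: (hN T)|exact: ltW].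
Qed.

(* Greedily pick disjoint blocks of [A] on which [u] has mass at least 1 and
   [v] has mass at most 2^-k; smallness of [v] itself (and not only of [v / u])
   controls the last, overshooting, term of each block. *)
Lemma sparse_subset u v A : (forall n, 0 <= u n) -> (forall n, 0 <= v n) ->
  ~ ideal_of u A ->
  (forall e, 0 < e -> \forall n \near \oo, A n -> v n <= e /\ v n <= e * u n) ->
  exists B, ideal_of v B /\ ~ ideal_of u B.
Proof.
move=> u0 v0 nuA h.
(* The factor 1/2 offsets the 2 in [light_block]: block [k] gets the bound 2^-(k+1), and these
   bounds sum to 1. *)
have e0 k : 0 < 2^-1 / (2 ^ k.+1)%:R :> R by rewrite divr_gt0// ltr0n expn_gt0.
have /choice[g gP] : forall kM : nat * nat, exists NT : nat * nat,
    [/\ (kM.2 <= NT.1)%N, (NT.1 <= NT.2)%N,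
    1 <= \sum_(NT.1 <= n < NT.2 | n \in A) u n &
    \sum_(NT.1 <= n < NT.2 | n \in A) v n <= (2^-1 / (2 ^ kM.1.+1)%:R) * 2].
  move=> [k M] /=.
  have [N [T NTP]] := @light_block u v A _ M (e0 k) u0 v0 nuA (h _ (e0 k)).
  by exists (N, T).
(* Each block is sought from where the previous one ended, which makes the blocks disjoint. *)
pose M := fix M k := if k is k'.+1 then (g (k', M k')).2 else 0%N.
pose r k := [seq n <- index_iota (g (k, M k)).1 (g (k, M k)).2 | n \in A].
pose F k := [set` r k].
have ur k : uniq (r k) by rewrite filter_uniq// iota_uniq.
have homoM : {homo M : i j / (i <= j)%N}.
  apply: homo_leq => [//|j i k /leq_trans|k]; first exact.
  by have [h1 h2 _ _] := gP (k, M k); apply: leq_trans h2.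
have FM k n : F k n -> (M k <= n < M k.+1)%N.
  rewrite /F /r /= mem_filter mem_index_iota => /and3P[_ h1 ->]; rewrite andbT.
  by have [+ _ _ _] := gP (k, M k) => /leq_trans; apply.
have tF : trivIset setT F.
  apply: ltn_trivIset => n m mn; apply/seteqP; split => // i [] /FM/andP[_ h1].
  move=> /FM/andP[h2 _]; have := leq_trans h1 (leq_trans (homoM _ _ mn) h2).
  by rewrite ltnn.
exists (\bigcup_k F k); rewrite /ideal_of /=; split.
  rewrite nneseries_sum_bigcup//.
  apply: (@le_lt_trans _ _ 1%:E); last exact: ltry.
  apply: le_trans (epsilon_trick0 xpredT ler01).
  apply: lee_nneseries => k.
    by move=> _ _; apply: esum_ge0 => n _; rewrite lee_fin.
  move=> _.
  rewrite esum_seq// big_filter lee_fin.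
  by have [_ _ _ /le_trans] := gP (k, M k); apply; rewrite /= mulrAC mulVf.
apply/negP; rewrite -leNgt.
rewrite nneseries_sum_bigcup//.
have <- : (\sum_(0 <= i <oo) (1:R)%:E = +oo)%E.
  apply/cvg_lim => //.
  have -> : (fun n => \sum_(0 <= i < n) (1:R)%:E)%E = (fun n : nat => (n%:R)%:E).
    by apply/funext => n; rewrite sumEFin sumr_const_nat subn0.
  exact/cvgenyP.
apply: lee_nneseries => k _; first by rewrite lee_fin.
rewrite esum_seq// big_filter lee_fin.
by have [] := gP (k, M k).
Qed.

Lemma ideal_eq_ratio0 u v A : (forall n, 0 <= u n) -> (forall n, 0 <= v n) ->
  ideal_of u = ideal_of v ->
  (forall e, 0 < e -> \forall n \near \oo, A n -> v n <= e /\ v n <= e * u n) ->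
  ideal_of u A.
Proof.
move=> u0 v0 uv h; apply: contrapT => nuA.
by have [B []] := sparse_subset u0 v0 nuA h; rewrite uv.
Qed.

End Ideals.

(** * Criteria for inequivalence to [calY] and for nonisomorphism *)

Section Criteria.
Variable R : realType.
Implicit Types (x y : R^nat).

Lemma not_equiv_calY x : (forall n, 0 < x n <= 1) -> x n @[n --> \oo] --> 0 ->
  (forall n, ~~ odd n -> x n.+1 = x n ^+ 4) -> ~ ideal_of x [set n | odd n] ->
  forall y, calY y -> ~ ideal_equiv x y.
Proof.
move=> x01 x0 x4 nodd y [[y_gt0 _] liminf_gt0] xy; apply: nodd.
have x_gt0 n : 0 < x n by case/andP: (x01 n).
have x_ge0 n := ltW (x_gt0 n); have y_ge0 n := ltW (y_gt0 n).
have x_small e : 0 < e -> \forall n \near \oo, x n <= e by exact: cvgr_le.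
have [c c0 yc] : exists2 c : R, 0 < c & \forall n \near \oo, c * y n <= y n.+1.
  have [c c0 hc] : exists2 c : R, 0 < c &
      (c%:E < limn_einf (fun n => (y n.+1 / y n)%:E))%E.
    (* Half of the liminf if it is finite, and 1 if it is infinite. *)
    case: (limn_einf _) liminf_gt0 => [l||//]; last by exists 1; rewrite ?ltry.
    by rewrite lte_fin => l0; exists (l / 2); rewrite ?lte_fin; lra.
  exists c => //; rewrite limn_einf_lim in hc.
  have [N _ hN] := lte_lim (@nondecreasing_einfs _ _) (@is_cvg_einfs _ _) hc.
  exists N => // n /= Nn; rewrite -ler_pdivlMr// -lee_fin.
  by apply: le_trans (hN n Nn) _; apply: ereal_inf_lbound; exists n => /=.
(* The cut is at the square root of [x], which at n + 1 with n even equals [x n ^+ 2]. On [P], x / y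
   is at most the square root of x, which tends to 0; on [Q], eventually
   [c * y n <= y n.+1 < x n ^+ 2], so y / x tends to 0. *)
pose P := [set n | odd n /\ x n <= y n ^+ 2].
pose Q := [set n | ~~ odd n /\ y n.+1 ^+ 2 < x n.+1].
have xP : ideal_of x P.
  rewrite xy; apply: (ideal_eq_ratio0 (v := x)) => // e e0.
  have e20 : 0 < e ^+ 2 by rewrite exprn_gt0.
  near=> n => -[_ xy2].
  have xe : x n <= e by near: n; exact: x_small.
  have xe2 : x n <= e ^+ 2 by near: n; exact: x_small.
  split=> //; rewrite -ler_sqr ?nnegrE ?mulr_ge0 ?(ltW e0)//.
  by rewrite exprMn [leLHS]expr2 ler_pM.
have xQ : ideal_of x Q.
  apply: (ideal_eq_ratio0 (v := y)) => // e e0.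
  have ec0 : 0 < e * c by rewrite mulr_gt0.
  near=> n => -[evn]; rewrite x4// => yx.
  have xe : x n <= e * c by near: n; exact: x_small.
  have cy : c * y n <= y n.+1 by near: n.
  have yx2 : y n.+1 < x n ^+ 2.
    by rewrite -ltr_sqr ?nnegrE ?exprn_ge0// -exprM.
  suff yex : y n <= e * x n.
    split=> //; apply: le_trans yex _; rewrite ler_piMr ?(ltW e0)//.
    by case/andP: (x01 n).
  rewrite -(ler_pM2l c0); apply: le_trans cy (le_trans (ltW yx2) _).
  by rewrite expr2 mulrCA mulrA ler_pM2r// mulrC.
(* An odd integer outside [P] is the successor of an element of [Q]; the shift stays in the ideal
   since x_(n+1) = x_n^4 <= x_n on [Q]. *)
apply: (ideal_of_cover (A := P) (B := S @` Q)) => //.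
  case=> // n /= oddn; have [xy2|xy2] := lerP (x n.+1) (y n.+1 ^+ 2).
    by left.
  by right; exists n.
apply/ideal_of_image; first by move=> ? ? [].
apply: le_ideal_of xQ => n [evn _] /=; rewrite x4//.
by rewrite exprSr ler_piMl// exprn_ile1//; case/andP: (x01 n).
Unshelve. all: by end_near. Qed.

(** Along a bijection [f], [x \o f] and [y] would have the same ideal. Wherever one of the two is
    smaller it is negligible against the other, so two sets of the ideal would cover all integers.
    The separation is uniform in [n] because nothing is known about [f]. *)
Lemma not_isomorphic_ideals x y : (forall n, 0 < x n) -> (forall n, 0 < y n) ->
  y n @[n --> \oo] --> 0 -> ~ ideal_of y [set: nat] ->
  (forall e, 0 < e -> \forall m \near \oo, forall n,
     x n <= e * y m \/ y m <= e * x n) ->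
  ~ isomorphic_ideals (ideal_of x) (ideal_of y).
Proof.
move=> x0 y0 y_to0 yT sep [f [/bij_inj fI fP]]; apply: yT.
pose u := x \o f.
have uy : ideal_of u = ideal_of y.
  by apply/seteqP; split=> A; [move=> /ideal_of_image-/(_ fI)/fP
                              |move=> /fP/ideal_of_image; exact].
have u_ge0 n : 0 <= u n by exact/ltW/x0.
have y_ge0 n : 0 <= y n by exact: ltW.
have key e : 0 < e -> \forall n \near \oo,
    (y n <= u n -> y n <= e * u n) /\ (u n < y n -> u n <= e * y n).
  (* With [d < 1] the two alternatives exclude each other, so the order of [y n] and [u n] tells
     which one holds. *)
  move=> e0; pose d := Num.min e 2^-1.
  have d0 : 0 < d by rewrite lt_min e0 invr_gt0 ltr0n.
  have de : d <= e by rewrite ge_min lexx.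
  have d1 : d < 1 by rewrite gt_min; apply/orP; right; lra.
  near=> n; have un0 : 0 < u n := x0 (f n); have yn0 := y0 n.
  have [uy'|yu] : u n <= d * y n \/ y n <= d * u n.
    by rewrite /u /=; move: (f n); near: n; exact: sep.
  - by split=> [?|_]; nra.
  - by split=> [_|?]; nra.
have y_small e : 0 < e -> \forall n \near \oo, y n <= e by exact: cvgr_le.
apply: (ideal_of_cover (A := [set n | y n <= u n]) (B := [set n | u n < y n]))
  => //.
- by move=> n _ /=; have [h|h] := lerP (y n) (u n); [left|right].
- rewrite -uy; apply: (ideal_eq_ratio0 (v := y)) => // e e0.
  near=> n => /= yu; split; first by near: n; exact: y_small.
  by move: yu; near: n; apply: filterS (key _ e0) => n [].
- apply: (ideal_eq_ratio0 (v := u)) => // e e0.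
  near=> n => /= uy'; split.
    by apply: le_trans (ltW uy') _; near: n; exact: (y_small e).
  by move: uy'; near: n; apply: filterS (key _ e0) => n [].
Unshelve. all: by end_near. Qed.

End Criteria.

(** * The tower sequences and their separation *)

Section Family.
Variable R : realType.
Implicit Types (c d e : R).

(** The iterated logarithm keeps 4^level of order at most log n, so terms decay no faster than a
    power of n. Adding 2 makes the inner logarithm positive. *)
Definition level (n : nat) : nat := trunc_log 4 (trunc_log 2 n./2.+2) + odd n.

Definition tower_seq c : R^nat := fun n => expR (- (c * 4 ^+ level n)).

Lemma level_ge (N n : nat) : ((2 ^ (4 ^ N)).*2 <= n)%N -> (N <= level n)%N.
Proof.
move=> Nn; rewrite /level (leq_trans _ (leq_addr _ _))//.
apply: trunc_log_max => //; apply: trunc_log_max => //.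
by rewrite -[leqLHS]doubleK (leq_trans (half_leq Nn))// -addn2 leq_addr.
Qed.

Lemma pow_level_ge (K : R) : \forall n \near \oo, K <= 4 ^+ level n.
Proof.
have [N KN] : exists N : nat, K <= N%:R.
  by exists (Num.truncn K).+1; apply/ltW; exact: truncnS_gt.
exists (2 ^ (4 ^ N)).*2 => // n /= /level_ge Nn.
apply: le_trans KN _; rewrite -natrX ler_nat (leq_trans Nn)//.
exact/ltnW/ltn_expl.
Qed.

Lemma expR_level_le d e : 0 < d -> 0 < e ->
  \forall n \near \oo, expR (- (d * 4 ^+ level n)) <= e.
Proof.
move=> d0 e0; near=> n.
rewrite -[leRHS]lnK ?posrE// ler_expR lerNl -ler_pdivrMl//.
by near: n; exact: pow_level_ge.
Unshelve. all: by end_near. Qed.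

Lemma tower_seq_cvg0 c : 0 < c -> tower_seq c n @[n --> \oo] --> (0 : R).
Proof.
move=> c0; apply/cvgr0Pnorm_le => e e0; near=> n.
by rewrite ger0_norm ?expR_ge0//; near: n; exact: expR_level_le.
Unshelve. all: by end_near. Qed.

Lemma tower_seq01 c n : 0 < c -> 0 < tower_seq c n <= 1.
Proof.
move=> c0; rewrite expR_gt0 -expR0 ler_expR oppr_le0.
by rewrite mulr_ge0 ?ltW ?exprn_gt0.
Qed.

Lemma tower_seqS c n : ~~ odd n -> tower_seq c n.+1 = tower_seq c n ^+ 4.
Proof.
move=> evn; rewrite /tower_seq -expRM_natl /level /=.
rewrite uphalf_half (negbTE evn) add0n addn0 addn1 exprS.
by congr expR; ring.
Qed.

(** With m the truncated binary logarithm of p + 2, the term is exp(-t) with t <= 4m/8 = m/2, and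
    exp(-m/2) >= 2^-m >= 1/(p+2) >= 1/(2(p+1)). *)
Lemma tower_seq_odd_ge c p : c <= 8^-1 ->
  2^-1 * harmonic p <= tower_seq c p.*2.+1.
Proof.
move=> c8; rewrite /tower_seq /level /= odd_double uphalf_double addn1.
set m := trunc_log 2 p.+2.
have m0 : (0 < m)%N by rewrite trunc_log_gt0.
have jm : (4 : R) ^+ trunc_log 4 m <= m%:R by rewrite -natrX ler_nat trunc_logP.
have mp : 2 ^+ m <= p.+2%:R :> R by rewrite -natrX ler_nat trunc_logP.
apply: (@le_trans _ _ (2^-1 ^+ m)).
  rewrite /harmonic -invfM exprVn lef_pV2 ?posrE ?mulr_gt0 ?exprn_gt0//.
  apply: le_trans mp _; rewrite -natrM ler_nat.
  by rewrite mul2n -addnn addSnnS leq_addl.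
apply: (@le_trans _ _ (expR (m%:R * - 2^-1))).
  rewrite expRM_natl lerXn2r ?nnegrE ?expR_ge0//.
  (* This is exp(-1/2) >= 1 - 1/2. *)
  by have := expR_ge1Dx (- 2^-1 : R); lra.
rewrite ler_expR mulrN lerN2 exprS.
have : 0 < 4 ^+ trunc_log 4 m :> R by rewrite exprn_gt0.
nra.
Qed.

Lemma half_harmonic_notin_ideal :
  ~ ideal_of (fun n => 2^-1 * harmonic n : R) [set: nat].
Proof.
move=> h.
have /summable_cvg : summable (xpredT : pred nat)
    (fun n => (2^-1 * harmonic n : R)%:E).
  move: h; rewrite /ideal_of /summable /= -set_true; apply: le_lt_trans.
  by apply: le_esum => n _; rewrite lee_fin ger0_norm// mulr_ge0 ?harmonic_ge0.
move=> /(_ _)/(is_cvgZr (k := 2 : R)) cvg; apply: (@dvg_harmonic R).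
rewrite (_ : series harmonic =
    fun n => 2 *: \sum_(0 <= k < n) fine (2^-1 * harmonic k : R)%:E).
  by apply: cvg => n _; rewrite lee_fin mulr_ge0 ?harmonic_ge0.
apply/funext => n; rewrite /series /= scaler_sumr; apply: eq_bigr => k _.
by rewrite /= /GRing.scale /= mulrA divff// mul1r.
Qed.

Lemma tower_seq_odd c : c <= 8^-1 -> ~ ideal_of (tower_seq c) [set n | odd n].
Proof.
move=> c8 h; apply: half_harmonic_notin_ideal.
have oddE : [set n | odd n] = (fun p => p.*2.+1) @` [set: nat].
  apply/seteqP; split=> [n /= oddn|_ [p _ <-]/=]; last by rewrite odd_double.
  by exists n./2 => //; rewrite -[RHS]odd_double_half oddn.
have inj : injective (fun p => p.*2.+1) by move=> m n [] /double_inj.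
move: h; rewrite oddE => /(ideal_of_image _ _ inj); apply: le_ideal_of => p _.
exact: tower_seq_odd_ge.
Qed.

Lemma tower_seq_calA c : 0 < c -> c <= 8^-1 -> calA (tower_seq c).
Proof.
move=> c0 c8.
have x01 n := tower_seq01 n c0.
have x0 n : 0 < tower_seq c n by case/andP: (x01 n).
have nodd := tower_seq_odd c8.
split; last first.
  apply: not_equiv_calY => //; [exact: tower_seq_cvg0|exact: tower_seqS].
split; last exact: tower_seq_cvg0.
split => //; rewrite nneseries_esumT => [|n]; last by rewrite lee_fin ltW.
apply: contrapT => /eqP; rewrite -ltey => h; apply: nodd.
by apply: (ideal_of_cover (A := setT) (B := setT)) => // n; [exact: ltW|left].
Qed.

Lemma tower_seq_sep c d e : c != d -> 16^-1 < c < 8^-1 -> 16^-1 < d < 8^-1 ->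
  0 < e -> \forall m \near \oo, forall n,
    tower_seq c n <= e * tower_seq d m \/ tower_seq d m <= e * tower_seq c n.
Proof.
move=> cd /andP[c1 c2] /andP[d1 d2] e0.
(* Let a and b be the powers of 4 at [n] and [m]. Equal levels give the gap |c - d| b; if 4a <= b,
   then db - ca >= b/16 - b/32 = b/32; if 4b <= a, then ca - db >= b/4 - b/8. Each gap is at least
   [D] times b, whatever [n] is. *)
pose D := Num.min `|c - d| 32^-1.
have D0 : 0 < D by rewrite lt_min normr_gt0 subr_eq0 cd invr_gt0 ltr0n.
near=> m => n.
have sm : expR (- (D * 4 ^+ level m)) <= e by near: m; exact: expR_level_le.
suff : D * 4 ^+ level m <= `|c * 4 ^+ level n - d * 4 ^+ level m|.
  rewrite ler_normr => /orP[h|h]; [left|right];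
    rewrite -ler_pdivrMr ?expR_gt0//; apply: le_trans sm;
    by rewrite -expRN -expRD ler_expR; lra.
have [Dcd D32] : D <= `|c - d| /\ D <= 32^-1 by rewrite !ge_min !lexx orbT.
have p0 k : 0 < 4 ^+ k :> R by exact: exprn_gt0.
have p1 i j : (i < j)%N -> 4 * 4 ^+ i <= 4 ^+ j :> R.
  by move=> ij; rewrite -exprS ler_weXn2l// ler1n.
have := p0 (level n); have := p0 (level m).
have [nm|mn|->] := ltngtP (level n) (level m).
- rewrite ler_normr; have := p1 _ _ nm; set a := 4 ^+ _; set b := 4 ^+ _.
  move=> ab b0 a0.
  by apply/orP; right; nra.
- rewrite ler_normr; have := p1 _ _ mn; set a := 4 ^+ _; set b := 4 ^+ _.
  move=> ab b0 a0.
  by apply/orP; left; nra.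
- by move=> a0 _; rewrite -mulrBl normrM (ger0_norm (ltW a0)) ler_pM2r.
Unshelve. all: by end_near. Qed.

(* The interval ]1/16, 1/8[ has ratio 2 < 4, which keeps c 4^i and d 4^j apart
   for i <> j; the bound 1/8 makes the odd terms dominate a harmonic series. *)
Definition squash (r : R) : R := 16^-1 * (1 + (1 + expR r)^-1).

Lemma squash_itv r : 16^-1 < squash r < 8^-1.
Proof.
have h := expR_gt0 r; rewrite /squash.
have : 0 < (1 + expR r)^-1 < 1 by rewrite invr_gt0 invf_lt1; lra.
by lra.
Qed.

Lemma squash_inj : injective squash.
Proof.
move=> r s /(mulfI _)-/(_ _)/addrI/invr_inj/addrI/expR_inj; apply.
by rewrite invr_eq0 pnatr_eq0.
Qed.

Lemma tower_seq_not_isomorphic r s : r != s ->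
  ~ isomorphic_ideals (ideal_of (tower_seq (squash r)))
                      (ideal_of (tower_seq (squash s))).
Proof.
move=> rs.
have sq0 t : 0 < squash t by have /andP[] := squash_itv t; lra.
have sq8 t : squash t <= 8^-1 by have /andP[_ /ltW] := squash_itv t.
have t0 t n : 0 < tower_seq (squash t) n by exact: expR_gt0.
apply: not_isomorphic_ideals => //.
- exact: tower_seq_cvg0.
- move=> h; apply: (@tower_seq_odd (squash s)) => //.
  by apply: (ideal_of_cover (A := setT) (B := setT)) => // n; [exact: ltW|left].
- move=> e e0; apply: tower_seq_sep => //; try exact: squash_itv.
  by rewrite (inj_eq squash_inj).
Qed.

End Family.

Theorem theorem1p5 (R : realType) :
  exists B : set (R^nat),
    [/\ B `<=` @calA R,
        B #= [set: R] &
        forall x y : R^nat, B x -> B y -> x <> y ->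
          ~ isomorphic_ideals (ideal_of x) (ideal_of y)].
Proof.
exists ((fun r => tower_seq (squash r)) @` [set: R]); split.
- move=> _ [r _ <-]; have /andP[r1 r2] := squash_itv r.
  by apply: tower_seq_calA; lra.
(* Injectivity comes from nonisomorphism: equal sequences would have ideals isomorphic through the
   identity. *)
- apply: inj_card_eq => r s _ _ rs; apply/eqP/negPn/negP.
  move=> /tower_seq_not_isomorphic; rewrite /= rs; apply; exists id.
  by split; [exists id|move=> A; rewrite image_id].
- move=> _ _ [r _ <-] [s _ <-] rs; apply: tower_seq_not_isomorphic.
  by apply/eqP => rs'; apply: rs; rewrite rs'.
Qed.
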